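(* Let $X$ be a topological space. The following are equivalent: (1) $X$ satisfies $\mathsf{S}_1(\mathcal{O},\mathcal{O})$ and $\mathsf{U}_{\mathrm{fin}}(\mathcal{O},\Omega)$. (2) $X$ satisfies $\mathsf{S}_1(\Lambda,\gimel(\Omega))$. (3) $X$ satisfies $\mathsf{S}_1(\Omega,\gimel(\Omega))$. (4) ONE has no winning strategy in the game $\mathsf{G}_1(\Omega,\gimel(\Omega))$. (5) $\Omega\to(\gimel(\Omega))^2_2$ holds. (6) $\Omega\to(\gimel(\Omega))^2_k$ holds for all positive integers $k$.
   Context: Convention: a cover of the topological space $X$ is always a countable collection $\mathcal{U}$ of open subsets of $X$ such that $\bigcup\mathcal{U}=X$ and $X\notin\mathcal{U}$. $\mathscr{A},\mathscr{B}$ denote families of such covers of the underlying space $X$. $\mathcal{O}$ is the family of all covers of $X$. $\mathcal{U}$ is a large cover if each $x\in X$ belongs to infinitely many $U\in\mathcal{U}$; $\Lambda$ is the family of all large covers of $X$. $\mathcal{U}$ is an $\omega$-cover if $X\notin\mathcal{U}$ and for each finite $F\subseteq X$ there is $U\in\mathcal{U}$ with $F\subseteq U$; $\Omega$ is the family of all $\omega$-covers of $X$. A cover $\mathcal{U}$ of $X$ is multifinite if there is a partition of $\mathcal{U}$ into infinitely many finite covers of $X$. $\gimel(\mathscr{A})$ is the family of all covers $\mathcal{U}$ of $X$ such that either $\mathcal{U}$ is multifinite, or there is a partition $\mathcal{P}$ of $\mathcal{U}$ into finite sets such that $\{\bigcup\mathcal{F}:\mathcal{F}\in\mathcal{P}\}\setminus\{X\}\in\mathscr{A}$.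 $\mathsf{U}_{\mathrm{fin}}(\mathscr{A},\mathscr{B})$: for each sequence $\{\mathcal{U}_n\}_{n\in\mathbb{N}}$ of elements of $\mathscr{A}$ which do not contain a finite subcover, there are finite (possibly empty) subsets $\mathcal{F}_n\subseteq\mathcal{U}_n$, $n\in\mathbb{N}$, such that $\{\bigcup\mathcal{F}_n:n\in\mathbb{N}\}\in\mathscr{B}$. $\mathsf{S}_1(\mathscr{A},\mathscr{B})$: for each sequence $\{\mathcal{U}_n\}_{n\in\mathbb{N}}$ of elements of $\mathscr{A}$ there are $U_n\in\mathcal{U}_n$, $n\in\mathbb{N}$, such that $\{U_n:n\in\mathbb{N}\}\in\mathscr{B}$. $\mathsf{G}_1(\mathscr{A},\mathscr{B})$ is the game of two players, ONE and TWO, with an inning for each natural number $n$: in the $n$th inning ONE chooses $\mathcal{U}_n\in\mathscr{A}$ and TWO answers with $U_n\in\mathcal{U}_n$. TWO wins if $\{U_n:n\in\mathbb{N}\}\in\mathscr{B}$; otherwise ONE wins. $[A]^n$ denotes the set of $n$-element subsets of $A$. For positive integers $n,k$, the ordinary partition relation $\mathscr{A}\to(\mathscr{B})^n_k$ means: for each $A\in\mathscr{A}$ and each $f:[A]^n\to\{1,\dots,k\}$ there is $B\subseteq A$ such that $B\in\mathscr{B}$ and $f|_{[B]^n}$ is constant. *)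

(* Defs.v *)
From mathcomp Require Import all_boot.
From mathcomp Require Import boolp classical_sets functions cardinality.
From mathcomp Require Import topology.

Set Implicit Arguments.
Unset Strict Implicit.
Unset Printing Implicit Defensive.

Local Open Scope classical_set_scope.

Definition Union (T : Type) (F : set (set T)) : set T := \bigcup_(U in F) U.

Section Covers.
Variable X : topologicalType.
Implicit Types A B : set (set (set X)).

(* The convention on covers (countable, open, not containing the whole space) is
   built in here; every family below consists of such covers. *)
Definition O_covers : set (set (set X)) :=
  [set U | [/\ countable U, (forall V, U V -> open V),
               Union U = setT & ~ U setT]].

Definition Lambda_covers : set (set (set X)) :=
  [set U | O_covers U /\
    forall x : X, infinite_set [set V | U V /\ V x]].

Definition Omega_covers : set (set (set X)) :=
  [set U | O_covers U /\
    forall E : set X, finite_set E -> exists V, U V /\ E `<=` V].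

Definition multifinite (U : set (set X)) : Prop :=
  exists P : set (set (set X)),
    [/\ partition P id U, infinite_set P
      & forall F, P F -> finite_set F /\ O_covers F].

Definition gimel A : set (set (set X)) :=
  [set U | O_covers U /\
    (multifinite U \/
     exists P : set (set (set X)),
       [/\ partition P id U, (forall F, P F -> finite_set F)
         & A ([set Union F | F in P] `\ setT)])].

Definition has_finite_subcover (U : set (set X)) : Prop :=
  exists F, [/\ finite_set F, F `<=` U & Union F = setT].

Definition Ufin A B : Prop :=
  forall U : nat -> set (set X),
    (forall n, A (U n) /\ ~ has_finite_subcover (U n)) ->
    exists F : nat -> set (set X),
      (forall n, finite_set (F n) /\ F n `<=` U n) /\
      B (range (fun n => Union (F n))).

Definition S1 A B : Prop :=
  forall U : nat -> set (set X), (forall n, A (U n)) ->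
    exists V : nat -> set X, (forall n, U n (V n)) /\ B (range V).

(* A strategy for ONE in G_1(A, B) maps the list of the answers given so far by
   TWO to ONE's next move.  It is required to take values in A on all lists;
   its values on lists that are not legal histories do not affect any play. *)
Definition G1_strategy_ONE A (sigma : seq (set X) -> set (set X)) : Prop :=
  forall s, A (sigma s).

Definition G1_play (sigma : seq (set X) -> set (set X)) (V : nat -> set X) :
    Prop :=
  forall n, sigma (mkseq V n) (V n).

Definition G1_winning_ONE A B (sigma : seq (set X) -> set (set X)) : Prop :=
  G1_strategy_ONE A sigma /\
  forall V, G1_play sigma V -> ~ B (range V).

End Covers.

Definition n_subsets (T : Type) (n : nat) (U : set T) : set (set T) :=
  [set s | s `<=` U /\ (s #= `I_n)%card].

(* Only the values of f on n_subsets n U matter; for 0 < k every k-colouring of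
   n_subsets n U extends to a total function. *)
Definition arrow (T : Type) (A B : set (set T)) (n k : nat) : Prop :=
  forall U, A U -> forall f : set T -> 'I_k,
    exists V, [/\ V `<=` U, B V
      & exists j : 'I_k, forall s, n_subsets n V s -> f s = j].

(* Main.v *)
Require Import Defs.
From mathcomp Require Import all_boot.
From mathcomp Require Import boolp classical_sets functions cardinality.
From mathcomp Require Import topology.

Local Open Scope classical_set_scope.

(** Everything goes through the game on large covers.  Write (1) for the
conjunction of S1(O, O) and U_fin(O, Omega).

From (1) to the game.  By S1(O, O), ONE has no strategy that prevents TWO from
covering every point infinitely often (Pawlikowski's theorem, [rothberger_game]
below).  Its proof has two stages.  [menger_game] bounds TWO's moves: it finds
numbers mu n such that every point is, for infinitely many n, covered by one of
the sets with index at most mu n at every position of length n that respects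
the earlier bounds.  At each length there are then only finitely many positions
to consider, and [rothberger_select] picks one set in the common refinement of
the covers played there; that choice tells TWO what to answer whatever the
position turns out to be.  When ONE plays large covers, the sets already taken can
be deleted from each move, so the sets chosen by TWO are pairwise distinct.
U_fin(O, Omega), applied to the tails of the resulting sequence, groups it into
finite intervals that witness membership in gimel(Omega) ([gimel_range]).
Hence ONE has no winning strategy in G1(Lambda, gimel(Omega)); since every
omega-cover is large, this gives (2), (3) and (4).

From the game to the partition relation.  On a given omega-cover there is an
ultrafilter all of whose elements are omega-covers.  With respect to it, every
set V has a colour that the pair {V, W} takes for almost all W, and almost all V
have the same such colour.  ONE plays so as to force TWO to build a homogeneous
set, and a play that TWO wins is the one required ([game_arrow]).

Back to (1).  Both S1(Omega, gimel(Omega)) and the partition relation for pairs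
and two colours yield an element of gimel(Omega) with members contained in
members of the given covers, no cover being used twice ([refining_selection]).
That suffices for S1(O, O), through finite unions of members of the covers of a
whole block of indices, and for U_fin(O, Omega), through an increasing sequence
of sets that refines all covers up to a given index. *)

(** * Infinitely many indices, and enumerations *)

Definition infinitely_often (P : nat -> Prop) : Prop :=
  forall N, exists n, N <= n /\ P n.

Lemma infinitely_oftenW (P Q : nat -> Prop) :
  (forall n, P n -> Q n) -> infinitely_often P -> infinitely_often Q.
Proof. by move=> PQ h N; have [n [? /PQ ?]] := h N; exists n. Qed.

Lemma injective_unbounded (f : nat -> nat) (N : nat) : injective f ->
  exists K, forall k, K <= k -> N <= f k.
Proof.
move=> finj; elim: N => [|N [K hK]]; first by exists 0.
have [[k0 fk0]|no] := pselect (exists k, f k = N); last first.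
  exists K => k /hK; rewrite leq_eqVlt => /orP[/eqP fk|//].
  by case: no; exists k.
exists (maxn K k0.+1) => k; rewrite geq_max => /andP[/hK Kk k0k].
rewrite ltn_neqAle Kk andbT; apply/eqP => fk.
by move: k0k; rewrite (finj k0 k) ?ltnn// fk0.
Qed.

Lemma infinitely_often_inj (f : nat -> nat) (P : nat -> Prop) :
  injective f -> infinitely_often (fun k => P (f k)) -> infinitely_often P.
Proof.
move=> finj h N; have [K hK] := injective_unbounded f N finj.
by have [k [/hK ? ?]] := h K; exists (f k).
Qed.

Lemma finite_set_bounded (T : Type) (E : set T) (P : T -> nat -> Prop) :
  finite_set E -> (forall x m n, m <= n -> P x m -> P x n) ->
  (forall x, E x -> exists n, P x n) -> exists n, forall x, E x -> P x n.
Proof.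
move=> + Pmono; elim/Pchoice: T => T in E P Pmono *.
move=> /finite_seqP[s ->]; elim: s => [|a s IH] h; first by exists 0.
have [|m hm] := IH.
  by move=> x xs; apply: h; rewrite /= inE (xs : x \in s) orbT.
have [n hn] : exists n, P a n by apply: h; rewrite /= inE eqxx.
exists (maxn m n) => x /=; rewrite inE => /orP[/eqP ->|xs].
  by apply: Pmono hn; rewrite leq_maxr.
by apply: Pmono (hm _ xs); rewrite leq_maxl.
Qed.

Lemma countable_range (T : Type) (U : set T) :
  countable U -> U !=set0 -> exists e : nat -> T, range e = U.
Proof.
move=> /pfcard_geP[->[]//|[g]] _; exists g; apply/seteqP; split.
  by move=> _ [n _ <-]; exact: funS.
by move=> y Uy; have [n _ <-] := @surj _ _ _ _ g y Uy; exists n.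
Qed.

Lemma range_countable (I : countType) (T : Type) (f : I -> T) :
  countable (range f).
Proof. exact: sub_countable (card_image_le _ _) (countableP _). Qed.

Lemma countableS (T : Type) (A B : set T) :
  A `<=` B -> countable B -> countable A.
Proof. by move=> AB; apply: sub_countable; exact: subset_card_le. Qed.

(** * Covers, large covers and omega-covers *)

Lemma O_covers_range (X : topologicalType) (I : countType) (A : I -> set X) :
  (forall i, open (A i)) -> (forall x, exists i, A i x) ->
  (forall i, A i <> setT) -> O_covers (range A).
Proof.
move=> Aop Acov AT; split.
- exact: range_countable.
- by move=> _ [i _ <-].
- apply/seteqP; split=> // x _; have [i Aix] := Acov x.
  by exists (A i) => //; exists i.
- by move=> [i _ /AT].
Qed.

Lemma O_cover_enum (X : topologicalType) (x0 : X) (U : set (set X)) :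
  O_covers U -> exists e : nat -> set X, range e = U.
Proof.
move=> [cU _ UT _]; apply: countable_range => //.
have : Union U x0 by rewrite UT.
by case=> V UV _; exists V.
Qed.

Lemma O_cover_mem (X : topologicalType) (U : set (set X)) (x : X) :
  O_covers U -> exists V, U V /\ V x.
Proof.
move=> [_ _ UT _]; have : Union U x by rewrite UT.
by case=> V ? ?; exists V.
Qed.

Lemma O_cover_open (X : topologicalType) (U : set (set X)) (V : set X) :
  O_covers U -> U V -> open V.
Proof. by move=> [_ Uop _ _] UV; apply: Uop. Qed.

Lemma neqT_ex (T : Type) (V : set T) : V <> setT -> exists y, ~ V y.
Proof.
move=> VT; apply: contrapT => h; apply: VT.
by apply/seteqP; split=> // y _; apply: contrapT => nVy; apply: h; exists y.
Qed.

Lemma O_cover_proper (X : topologicalType) (U : set (set X)) (V : set X) :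
  O_covers U -> U V -> exists y, ~ V y.
Proof.
by move=> [_ _ _ UT] UV; apply: neqT_ex => VT; apply: UT; rewrite -VT.
Qed.

Lemma Omega_covers_intro (X : topologicalType) (U : set (set X)) :
  countable U -> (forall V, U V -> open V) -> ~ U setT ->
  (forall E : set X, finite_set E -> exists V, U V /\ E `<=` V) ->
  Omega_covers U.
Proof.
move=> cU oU UT h; split=> //; split=> //.
apply/seteqP; split=> // x _.
have [V [UV xV]] := h _ (finite_set1 x).
by exists V => //; apply: xV.
Qed.

(** Adding to [E] a point outside each member of [S] gives a finite set that
no member of [S] contains. *)
Lemma Omega_infinite (X : topologicalType) (U : set (set X)) (E : set X)
    (S : set (set X)) : Omega_covers U -> finite_set E -> finite_set S ->
  exists V, [/\ U V, ~ S V & E `<=` V].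
Proof.
move=> [Oc Uom] Efin Sfin.
have [x0 _] : [set: X] !=set0.
  have [V [UV _]] := Uom _ Efin.
  by have [y] := O_cover_proper _ _ _ Oc UV; exists y.
have /choice[y hy] : forall V, exists y, U V -> ~ V y.
  move=> V; have [UV|] := pselect (U V); last by exists x0.
  by have [y ?] := O_cover_proper _ _ _ Oc UV; exists y.
have [V [UV EV]] : exists V, U V /\ (E `|` [set y V | V in S]) `<=` V.
  by apply: Uom; rewrite finite_setU; split => //; exact: finite_image.
exists V; split=> //; last by move=> x Ex; apply: EV; left.
by move=> SV; apply: (hy V UV); apply: EV; right; exists V.
Qed.

Lemma Omega_sub_Lambda (X : topologicalType) :
  @Omega_covers X `<=` @Lambda_covers X.
Proof.
move=> U Uom; split; first by case: Uom.
move=> x fin.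
have [V [UV nV xV]] := Omega_infinite _ _ _ _ Uom (finite_set1 x) fin.
by apply: nV; split=> //; exact: xV.
Qed.

Lemma Omega_infinitely_often (X : topologicalType) (W : nat -> set X)
    (E : set X) : Omega_covers (range W) -> finite_set E ->
  infinitely_often (fun n => E `<=` W n).
Proof.
move=> Wom Efin N.
have [_ [[n _ <-] nW EW]] :=
  Omega_infinite _ _ _ _ Wom Efin (finite_image W (finite_II N)).
exists n; split=> //; rewrite leqNgt; apply/negP => nN.
by apply: nW; exists n.
Qed.

(** * The game for S1(O, O) *)

(** S1(O, O) for indexed families.  The sets may equal the whole space, in which
case one index already suffices; this is the case that the convention on covers
excludes. *)
Lemma rothberger_choice (X : topologicalType) (x0 : X) (I : countType)
    (A : nat -> I -> set X) :
  S1 (@O_covers X) (@O_covers X) -> (forall n i, open (A n i)) ->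
  (forall n x, exists i, A n i x) ->
  exists M : nat -> I, forall x, exists n, A n (M n) x.
Proof.
move=> S1O Aop Acov.
have [[n [i AT]]|nT] := pselect (exists n i, A n i = setT).
  have [d hd] := choice (fun m => Acov m x0).
  exists (fun m => if m == n then i else d m) => x; exists n.
  by rewrite eqxx AT.
have [n|V [hV [_ _ Vcov _]]] := S1O (fun n => range (A n)).
  apply: O_covers_range => // i AT; apply: nT; by exists n, i.
have /choice[M hM] : forall n, exists i, A n i = V n.
  by move=> n; have [i] := hV n; exists i.
exists M => x; have : Union (range V) x by rewrite Vcov.
by move=> [_ [n _ <-] Vx]; exists n; rewrite hM.
Qed.

(** The sequence of covers is split into infinitely many sequences, and each of
them contributes an index at which a given point is covered. *)
Lemma rothberger_choice_io (X : topologicalType) (x0 : X) (I : countType)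
    (A : nat -> I -> set X) :
  S1 (@O_covers X) (@O_covers X) -> (forall n i, open (A n i)) ->
  (forall n x, exists i, A n i x) ->
  exists M : nat -> I, forall x, infinitely_often (fun n => A n (M n) x).
Proof.
move=> S1O Aop Acov.
have /choice[M hM] : forall k : nat, exists M : nat -> I,
    forall x, exists j, A (pickle (k, j)) (M j) x.
  by move=> k; exact: (rothberger_choice _ x0 _ (fun j => A (pickle (k, j)))).
have [i0 _] := Acov 0 x0.
exists (fun n => if unpickle n is Some kj then M kj.1 kj.2 else i0) => x.
have /choice[j hj] : forall k : nat, exists j, A (pickle (k, j)) (M k j) x.
  by move=> k; exact: hM.
(* One index for each [k]; they are distinct, hence unbounded. *)
apply: (infinitely_often_inj (fun k => pickle (k, j k))).
  by move=> k l /(pcan_inj pickleK)[].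
by move=> N; exists N; split=> //; rewrite pickleK.
Qed.

Lemma filter_all_seq (T : Type) (F : set_system T) {FF : Filter F} (K : eqType)
    (L : seq K) (Q : K -> set T) :
  (forall s, s \in L -> F (Q s)) ->
  F [set y | forall s, s \in L -> Q s y].
Proof.
elim: L => [|a L IH] h; first by apply: filterE.
have Qa : F (Q a) by apply: h; rewrite inE eqxx.
have QL : F [set y | forall s, s \in L -> Q s y].
  by apply: IH => s sL; apply: h; rewrite inE sL orbT.
by apply: filterS2 Qa QL => y Qay QLy s; rewrite inE => /orP[/eqP ->//|/QLy].
Qed.

(** The finite set of all sequences of the length of [mu] bounded by [mu]
termwise.  It is built from the left, so that extending [mu] at its end extends
the members at their end, as a position grows in a play. *)
Definition box (mu : seq nat) : seq (seq nat) :=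
  foldl (fun B m => [seq rcons s a | s <- B, a <- iota 0 m.+1]) [:: [::]] mu.

Lemma mem_box_rcons (mu s : seq nat) (m a : nat) :
  (rcons s a \in box (rcons mu m)) = (s \in box mu) && (a <= m).
Proof.
rewrite /box foldl_rcons -/(box mu); apply/allpairsP/andP.
  by move=> [[s' a'] [s'B + /rcons_inj[-> ->]]]; rewrite mem_iota.
by move=> [sB am]; exists (s, a); split; rewrite // mem_iota.
Qed.

Lemma rcons_nseq (T : Type) (n : nat) (x : T) :
  nseq n.+1 x = rcons (nseq n x) x.
Proof. by elim: n => //= n <-. Qed.

Lemma box_nseqS (n M M' : nat) (s : seq nat) :
  M <= M' -> s \in box (nseq n M) -> s \in box (nseq n M').
Proof.
move=> MM'; elim: n s => [//|n IH] s; rewrite !rcons_nseq.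
case/lastP: s => [|s a].
  by rewrite /box foldl_rcons => /allpairsP[[[|? ?] ?] []].
by rewrite !mem_box_rcons => /andP[/IH -> /leq_trans]; exact.
Qed.

Lemma take_mkseq (T : Type) (f : nat -> T) (i n : nat) :
  i <= n -> take i (mkseq f n) = mkseq f i.
Proof. by move=> /minn_idPl im; rewrite /mkseq -map_take take_iota im. Qed.

(** Hurewicz's theorem that ONE has no winning strategy in the Menger game, for
increasing covers and with infinitely many successes for each point.  For a
fixed point and a fixed length, a play succeeds on all sequences of that length
except finitely many: bound the first move so that from there on it succeeds,
then bound the second move for each of the finitely many smaller first moves,
and so on.  So the sets of points whose finitely many exceptions are bounded by
M form, as M varies, an open cover, for each length.  A selection from these
covers gives moves large enough to leave the set of exceptions. *)
Lemma menger_game (X : topologicalType) (x0 : X) (G : seq nat -> nat -> set X) :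
  S1 (@O_covers X) (@O_covers X) -> (forall s m, open (G s m)) ->
  (forall s m n, m <= n -> G s m `<=` G s n) ->
  (forall s x, exists m, G s m x) ->
  exists mu : nat -> nat,
    forall x, infinitely_often (fun n => G (mkseq mu n) (mu n) x).
Proof.
move=> S1O Gop Gmono Gcov.
(* Only moves of value at least [k] count as successes.  A play has finitely
   many moves before a given inning, so success for unboundedly many [k] means
   success in unboundedly many innings. *)
pose P k s x := exists i,
  [/\ i < size s, k <= nth 0 s i & G (take i s) (nth 0 s i) x].
have P_rcons k s a x : P k s x -> P k (rcons s a) x.
  move=> [i [ilt ki Gi]]; exists i; split.
  - by rewrite size_rcons ltnW.
  - by rewrite nth_rcons ilt.
  - by rewrite nth_rcons ilt -cats1 takel_cat // ltnW.
pose D k n M : set X :=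
  [set x | forall s, size s = n -> s \notin box (nseq n M) -> P k s x].
(* The statement holds near [x], not only at [x]: this is the openness that
   the selection principle requires. *)
have Dnear k n (x : X) : exists M, \forall y \near x, D k n M y.
  elim: n => [|n [M0 IH]].
    by exists 0; apply: nearW => y s /size0nil ->.
  have [M1 hM1] : exists M1, forall s, s \in box (nseq n M0) ->
      \forall y \near x, G s M1 y.
    apply: (@finite_set_bounded _ [set` box (nseq n M0)]
      (fun s M1 => \forall y \near x, G s M1 y)).
    - exact: finite_seq.
    - by move=> s m m' /(Gmono s) mm'; apply: (@filterS _ (nbhs x)).
    - move=> s _; have [m Gm] := Gcov s x.
      by exists m; apply: open_nbhs_nbhs.
  exists (maxn k (maxn M0 M1)).
  have {}hM1 : \forall y \near x, forall s, s \in box (nseq n M0) -> G s M1 y.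
    exact: filter_all_seq.
  apply: (filterS2 _ _ IH hM1) => y Dy GM1 s.
  case/lastP: s => [//|s a]; rewrite size_rcons => -[ssz].
  rewrite rcons_nseq mem_box_rcons negb_and.
  have [sB|sB _] := boolP (s \in box (nseq n M0)); last first.
    by apply: P_rcons; exact: Dy.
  rewrite (box_nseqS _ M0)//=; last by rewrite leq_max leq_maxl orbT.
  rewrite -ltnNge !gtn_max => /and3P[ka _ M1a].
  exists n; rewrite nth_rcons ssz ltnn eqxx; split.
  - by rewrite size_rcons ssz.
  - exact: ltnW.
  - rewrite -cats1 -ssz take_size_cat//.
    by apply: Gmono (GM1 _ sB); exact: ltnW.
have [M hM] : exists M : nat -> nat, forall x,
    infinitely_often (fun n => (D n n.+1 (M n))° x).
  apply: (rothberger_choice_io _ x0 _ (fun n m => (D n n.+1 m)°)) => //.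
    by move=> n i; exact: open_interior.
  by move=> n x; exact: Dnear.
(* The last term of the play up to inning [n] exceeds [M n], so the play is
   not among the exceptions counted by [D n n.+1 (M n)]. *)
pose mu n := (M n).+1; exists mu => x N.
have [n [Nn /interior_subset Dx]] := hM x (\max_(i < N) mu i).+1.
have [||i [ilt]] := Dx (mkseq mu n.+1); first by rewrite size_mkseq.
  by rewrite rcons_nseq mkseqS mem_box_rcons /mu ltnn andbF.
rewrite size_mkseq in ilt.
rewrite nth_mkseq// => ni; rewrite take_mkseq ?(ltnW ilt)// => Gx.
exists i; split=> //; rewrite leqNgt; apply/negP => iN.
have := leq_bigmax (F := fun j : 'I_N => mu j) (Ordinal iN).
by move=> /(leq_trans ni); rewrite leqNgt Nn.
Qed.

(** A greedy choice: fewer than [size (S p)] values have been taken before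
step [p]. *)
Lemma distinct_representatives (S : nat -> seq nat) :
  (forall p, uniq (S p) /\ p < size (S p)) ->
  exists f : nat -> nat, injective f /\ forall p, f p \in S p.
Proof.
move=> hS.
pose pick (L : seq nat) p := head 0 [seq n <- S p | n \notin L].
pose fix pre p := if p is q.+1 then rcons (pre q) (pick (pre q) q) else [::].
have size_pre p : size (pre p) = p.
  by elim: p => //= p IH; rewrite size_rcons IH.
have pickP p : pick (pre p) p \in [seq n <- S p | n \notin pre p].
  have [Suniq Ssize] := hS p.
  rewrite /pick; case E : [seq n <- S p | n \notin pre p] => [|n L] /=.
    suff /(uniq_leq_size Suniq) : {subset S p <= pre p}.
      by rewrite size_pre leqNgt Ssize.
    move=> n nS; apply/negPn/negP => npre.
    have : n \in [seq n <- S p | n \notin pre p] by rewrite mem_filter npre.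
    by rewrite E.
  by rewrite inE eqxx.
have pre_mem p q : p < q -> pick (pre p) p \in pre q.
  elim: q => // q IH; rewrite ltnS leq_eqVlt /= mem_rcons inE.
  by move=> /orP[/eqP ->|/IH ->]; rewrite ?eqxx ?orbT.
exists (fun p => pick (pre p) p); split; last first.
  by move=> p; have := pickP p; rewrite mem_filter => /andP[].
move=> p q; wlog pq : p q / p < q.
  move=> h E; have [pq|qp|//] := ltngtP p q; first exact: h pq E.
  by apply/esym; apply: h qp (esym E).
move=> E; have := pickP q; rewrite mem_filter => /andP[+ _].
by rewrite -E pre_mem.
Qed.

Lemma infinitely_often_notin (P : nat -> Prop) (L : seq nat) :
  infinitely_often P -> exists n, n \notin L /\ P n.
Proof.
move=> /(_ (\max_(i <- L) i).+1)[n [nL Pn]]; exists n; split=> //.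
apply/negP => nL'.
have /= := leq_bigmax_seq (P := xpredT) (F := id) _ nL' isT.
by rewrite leqNgt nL.
Qed.

(** A single family need not cover the space.  Instead one selects, for each
[p], a whole list of sets taken from more than [p] different families, with
intersections that cover; each of these lists can then be charged to one of its
families that no earlier list uses. *)
Lemma rothberger_select (X : topologicalType) (x0 : X) (I : countType)
    (A : nat -> I -> set X) :
  S1 (@O_covers X) (@O_covers X) -> (forall n i, open (A n i)) ->
  (forall x, infinitely_often (fun n => exists i, A n i x)) ->
  exists a : nat -> I, forall x, infinitely_often (fun n => A n (a n) x).
Proof.
move=> S1O Aop Acov.
pose good p (w : seq (nat * I)) := uniq (unzip1 w) && (p < size w).
pose W p (w : seq (nat * I)) : set X :=
  [set x | good p w /\ forall e, e \in w -> A e.1 e.2 x].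
have Wop p w : open (W p w).
  rewrite openE => x [gw hw].
  have : \forall y \near x, forall e, e \in w -> A e.1 e.2 y.
    by apply: filter_all_seq => e /hw Ax; exact: open_nbhs_nbhs.
  by apply: filterS => y hy.
have Wcov p x : exists w, W p w x.
  suff [w [sw uw hw]] : exists w : seq (nat * I), [/\ size w = p.+1,
      uniq (unzip1 w) & forall e, e \in w -> A e.1 e.2 x].
    by exists w; split=> //; rewrite /good uw sw ltnSn.
  elim: p.+1 => [|q [w [sw uw hw]]]; first by exists [::].
  have [n [nw [i Ax]]] := infinitely_often_notin _ (unzip1 w) (Acov x).
  exists ((n, i) :: w); split=> /=; rewrite ?sw ?nw//.
  by move=> e; rewrite inE => /orP[/eqP ->//|/hw].
have [w0 hw0] := rothberger_choice_io _ x0 _ _ S1O Wop Wcov.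
(* An intersection selected in vain is replaced by any list with enough
   families, since representatives are needed at every [p]. *)
have /choice[w hw] : forall p, exists w, good p w /\ W p (w0 p) `<=` W p w.
  move=> p; have [g|ng] := boolP (good p (w0 p)).
    by exists (w0 p); split=> // x.
  have [w [g _]] := Wcov p x0; exists w; split=> // x [].
  by rewrite (negbTE ng).
have [f [finj fw]] : exists f : nat -> nat,
    injective f /\ forall p, f p \in unzip1 (w p).
  apply: distinct_representatives => p; rewrite size_map.
  by have [/andP] := hw p.
have [i0 _] : exists i : I, True.
  by have [n [_ [i _]]] := Acov x0 0; exists i.
have /choice[a ha] : forall n, exists i, forall p, f p = n -> (n, i) \in w p.
  move=> n; have [[p fp]|no] := pselect (exists p, f p = n); last first.
    by exists i0 => p fp; case: no; exists p.
  have := fw p; rewrite fp => /mapP[[m i] miw /= mE]; subst m.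
  by exists i => q fq; have -> : q = p by apply: finj; rewrite fp fq.
exists a => x; apply: (infinitely_often_inj f) => //.
apply: infinitely_oftenW (hw0 x) => p Wx.
have [_ wx] := (hw p).2 _ Wx.
by have := wx _ (ha _ p erefl).
Qed.

(** Pawlikowski's theorem in positional form: [T s] enumerates the cover played
after the answers [s] of TWO. *)
Lemma rothberger_game (X : topologicalType) (x0 : X)
    (T : seq nat -> nat -> set X) :
  S1 (@O_covers X) (@O_covers X) -> (forall s m, open (T s m)) ->
  (forall s x, exists m, T s m x) ->
  exists t : nat -> nat,
    forall x, infinitely_often (fun n => T (mkseq t n) (t n) x).
Proof.
move=> S1O Top Tcov.
pose G mu m : set X :=
  [set x | forall s, s \in box mu -> exists l, l <= m /\ T s l x].
have [mu hmu] : exists mu : nat -> nat,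
    forall x, infinitely_often (fun n => G (mkseq mu n) (mu n) x).
  apply: (menger_game _ x0) => // [s m|s m n mn x Gx t /Gx[l [lm Tx]]|s x].
  - rewrite openE => x Gx.
    have : \forall y \near x, forall t, t \in box s ->
        exists l, l <= m /\ T t l y.
      apply: filter_all_seq => t /Gx[l [lm Tx]].
      have := open_nbhs_nbhs (conj (Top t l) Tx); apply: filterS => y Ty.
      by exists l.
    exact: filterS.
  - by exists l; split=> //; exact: leq_trans mn.
  - apply: (@finite_set_bounded _ [set` box s]
      (fun t m => exists l, l <= m /\ T t l x)).
    + exact: finite_seq.
    + by move=> t m n mn [l [lm Tx]]; exists l; split=> //; exact: leq_trans mn.
    + by move=> t _; have [m Tm] := Tcov t x; exists m, m.
pose B n := box (mkseq mu n).
(* A list [a] of numbers, read along the enumeration of [B n], is a response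
   at each of the positions in [B n]; truncating it at [mu n] keeps the play
   inside these boxes. *)
pose f (a : seq nat) n s := minn (nth 0 a (index s (B n))) (mu n).
pose A n a : set X := [set x | forall s, s \in B n -> T s (f a n s) x].
have [a ha] : exists a : nat -> seq nat,
    forall x, infinitely_often (fun n => A n (a n) x).
  apply: (rothberger_select _ x0 _ A) => // [n a|x].
    rewrite openE => x Ax.
    have : \forall y \near x, forall s, s \in B n -> T s (f a n s) y.
      by apply: filter_all_seq => t /Ax Tx; exact: open_nbhs_nbhs.
    exact: filterS.
  apply: infinitely_oftenW (hmu x) => n Gx.
  have /choice[l hl] : forall s, exists l, s \in B n -> l <= mu n /\ T s l x.
    move=> s; have [/Gx[l hl]|_] := boolP (s \in B n); last by exists 0.
    by exists l.
  exists [seq l s | s <- B n] => s sB; have [lmu Tx] := hl s sB.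
  rewrite /f (nth_map [::]) ?index_mem// nth_index//.
  by move/minn_idPl: lmu => ->.
pose fix h n := if n is p.+1 then rcons (h p) (f (a p) p (h p)) else [::].
pose t n := f (a n) n (h n).
have hE n : h n = mkseq t n.
  by elim: n => //= n IH; rewrite mkseqS -IH.
have hB n : h n \in B n.
  elim: n => [|n IH]; first by rewrite /B /box /= inE.
  by rewrite /B /= mkseqS mem_box_rcons IH /f geq_minr.
exists t => x; apply: infinitely_oftenW (ha x) => n Ax.
by rewrite -hE; exact: Ax.
Qed.

(** * Grouping a sequence into intervals *)

Definition block (T : Type) (V : nat -> set T) (b : nat -> nat) (k : nat) :
    set (set T) :=
  [set V i | i in [set i | b k <= i < b k.+1]].

Arguments block {T}.

Lemma block_Union (T : Type) (V : nat -> set T) (b : nat -> nat) k x :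
  Union (block V b k) x <-> exists i, b k <= i < b k.+1 /\ V i x.
Proof.
split; first by move=> [_ [i ik <-] Vx]; exists i.
by move=> [i [ik Vx]]; exists (V i) => //; exists i.
Qed.

Lemma increasing_ge (b : nat -> nat) :
  (forall k, b k < b k.+1) -> forall k, k <= b k.
Proof. by move=> bS; elim=> // k /leq_ltn_trans; apply. Qed.

Lemma increasing_homo (b : nat -> nat) :
  (forall k, b k < b k.+1) -> {homo b : m n / m <= n}.
Proof.
by move=> bS; apply: homo_leq => // [? ? ?|k]; [exact: leq_trans|exact: ltnW].
Qed.

Lemma increasing_interval (b : nat -> nat) : b 0 = 0 ->
  (forall k, b k < b k.+1) -> forall i, exists k, b k <= i < b k.+1.
Proof.
move=> b0 bS i.
have ex : exists k, i < b k by exists i.+1; exact: increasing_ge.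
case: (ex_minnP ex) => -[|k]; first by rewrite b0.
move=> ik min; exists k; rewrite ik andbT leqNgt; apply/negP => /min.
by rewrite ltnn.
Qed.

Lemma block_eq (T : Type) (V : nat -> set T) (b : nat -> nat) (k l : nat) :
  injective V -> (forall k, b k < b k.+1) ->
  block V b k `&` block V b l !=set0 -> k = l.
Proof.
move=> Vinj bS [_ [[i /= ik <-] [j jl /Vinj ji]]]; subst j.
have bmono := increasing_homo _ bS.
move: ik jl => /andP[ki ik] /andP[li il].
apply/eqP; rewrite eqn_leq; apply/andP; split.
  rewrite -ltnS ltnNge; apply/negP => /bmono/leq_trans/(_ ki).
  by rewrite leqNgt il.
rewrite -ltnS ltnNge; apply/negP => /bmono/leq_trans/(_ li).
by rewrite leqNgt ik.
Qed.

Lemma block_neq0 (T : Type) (V : nat -> set T) (b : nat -> nat) (k : nat) :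
  b k < b k.+1 -> block V b k !=set0.
Proof. by move=> bS; exists (V (b k)); exists (b k); rewrite //= leqnn. Qed.

Lemma block_inj (T : Type) (V : nat -> set T) (b : nat -> nat) :
  injective V -> (forall k, b k < b k.+1) -> injective (block V b).
Proof.
move=> Vinj bS k l kl; apply: (block_eq _ V b) => //.
by rewrite kl setIid; exact: block_neq0.
Qed.

Lemma block_partition (T : Type) (V : nat -> set T) (b : nat -> nat) :
  injective V -> b 0 = 0 -> (forall k, b k < b k.+1) ->
  partition (range (block V b)) id (range V).
Proof.
move=> Vinj b0 bS; split.
- apply/seteqP; split=> [_ [_ [k _ <-] [i _ <-]]|_ [i _ <-]]; first by exists i.
  have [k ik] := increasing_interval _ b0 bS i.
  by exists (block V b k); [exists k|exists i].
- by move=> _ _ [k _ <-] [l _ <-] /(block_eq _ _ _ _ _ Vinj bS) ->.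
- by move=> _ [k _ <-]; exact: block_neq0.
Qed.

Lemma finite_block (T : Type) (V : nat -> set T) b k : finite_set (block V b k).
Proof.
apply: finite_image; apply: (sub_finite_set _ (finite_II (b k.+1))).
by move=> i /= /andP[].
Qed.

Lemma range_infinite (T : Type) (f : nat -> T) :
  injective f -> infinite_set (range f).
Proof.
move=> finj; have fcard : (range f #= [set: nat])%card.
  by apply: inj_card_eq => m n _ _; exact: finj.
by rewrite (eq_finite_set fcard); exact: infinite_nat.
Qed.

(** If every tail has a finite subcover, consecutive intervals that cover the
space show that the family is multifinite.  Otherwise U_fin(O, Omega), applied
to the tails after some [N0], gives finite parts with unions that form an
omega-cover; each part lies in the union of two consecutive intervals of a fast
growing sequence [c].  Pairing intervals from an even or from an odd start must
work for all finite sets at once. *)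
Lemma gimel_range (X : topologicalType) (x0 : X) (V : nat -> set X) :
  Ufin (@O_covers X) (@Omega_covers X) -> injective V ->
  (forall i, open (V i)) -> (forall i, V i <> setT) ->
  (forall x, infinitely_often (fun i => V i x)) ->
  gimel (@Omega_covers X) (range V).
Proof.
move=> UF Vinj Vop VT Vio; split.
  by apply: O_covers_range => // x; have [i [_ ?]] := Vio x 0; exists i.
pose full N N' := N < N' /\ forall x, exists i, N <= i < N' /\ V i x.
have [/choice[h hh]|] := pselect (forall N, exists N', full N N').
  left; have [b [b0 bfull]] : exists b,
      b 0 = 0 /\ forall k, full (b k) (b k.+1).
    by exists (fun k => iter k h 0); split=> // k; exact: hh.
  have bS k : b k < b k.+1 by have [] := bfull k.
  exists (range (block V b)); split=> //.
  - exact: block_partition.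
  - exact: range_infinite (block_inj _ _ _ Vinj bS).
  - move=> _ [k _ <-]; split; first exact: finite_block.
    split.
    + exact: finite_set_countable (finite_block _ _ _ _).
    + by move=> _ [i _ <-].
    + apply/seteqP; split=> // x _; apply/block_Union; exact: (bfull k).2.
    + by move=> [i _ /VT].
move=> /existsNP[N0 nofull]; right.
have notfull m n : N0 <= m -> ~ forall x, exists i, m <= i < n /\ V i x.
  move=> Nm mn; apply: nofull; exists n; split.
    have [i [/andP[mi ilt] _]] := mn x0.
    exact: leq_ltn_trans Nm (leq_ltn_trans mi ilt).
  move=> x; have [i [/andP[mi ilt] Vx]] := mn x.
  by exists i; rewrite ilt (leq_trans Nm mi).
pose U n := range (fun i => V (N0 + n + i)).
have Ubounded n F : finite_set F -> F `<=` U n ->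
    exists m, forall W, F W -> exists i, N0 + n <= i < m /\ V i = W.
  move=> Ffin FU; apply: finite_set_bounded => //.
    move=> W m m' mm' [i [/andP[ni im] iW]]; exists i; split=> //.
    by rewrite ni (leq_trans im mm').
  move=> W /FU[i _ <-]; exists (N0 + n + i).+1; exists (N0 + n + i).
  by rewrite leq_addr ltnSn.
have [n|F [hF Fom]] := UF U.
  split.
    apply: O_covers_range => // x.
    have [i [ni Vx]] := Vio x (N0 + n).
    by exists (i - (N0 + n)); rewrite subnKC.
  move=> [F [Ffin FU FT]]; have [m hm] := Ubounded n F Ffin FU.
  apply: (notfull (N0 + n) m); first exact: leq_addr.
  move=> x; have [W FW Wx] : Union F x by rewrite FT.
  by have [i [im iW]] := hm W FW; exists i; rewrite iW.
have /choice[h hh] : forall n, exists m,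
    forall W, F n W -> exists i, N0 + n <= i < m /\ V i = W.
  by move=> n; have [Ffin FU] := hF n; exact: Ubounded.
have Eio E : finite_set E -> infinitely_often (fun n =>
    forall x, E x -> exists i, n <= i < h n /\ V i x).
  move=> /(Omega_infinitely_often _ _ _ Fom); apply: infinitely_oftenW => n EF.
  move=> x /EF[W FW Wx]; have [i [/andP[ni ih] iW]] := hh n W FW.
  by exists i; rewrite iW ih (leq_trans _ ni)// leq_addl.
pose fix c k :=
  if k is l.+1 then maxn (c l).+1 (\max_(n < (c l).+1) h n) else 0.
have cS k : c k < c k.+1 by rewrite /= leq_maxl.
have ch k n : n < c k.+1 -> h n <= c k.+2.
  have -> : c k.+2 = maxn (c k.+1).+1 (\max_(j < (c k.+1).+1) h j) by [].
  move=> /ltnW; rewrite -ltnS => nk; rewrite leq_max; apply/orP; right.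
  by have := leq_bigmax (F := fun j : 'I_(c k.+1).+1 => h j) (Ordinal nk).
have cmono := increasing_homo _ cS.
pose Q k (E : set X) := forall x, E x -> exists i, c k <= i < c k.+2 /\ V i x.
have QS k E E' : E `<=` E' -> Q k E' -> Q k E by move=> EE' QE x /EE'/QE.
have Qio E : finite_set E -> infinitely_often (fun k => Q k E).
  move=> /Eio EV N; have [n [Nn En]] := EV (c N).
  have [k /andP[kn nk]] := increasing_interval c erefl cS n.
  exists k; split.
    rewrite -ltnS ltnNge; apply/negP => /cmono.
    by rewrite leqNgt (leq_ltn_trans Nn nk).
  move=> x /En[i [/andP[ni ih] Vx]]; exists i; split=> //.
  by rewrite (leq_trans kn ni) (leq_trans ih (ch _ _ nk)).
(* If even starts fail for [E0], then odd starts work for every [E], because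
   they do for the union of [E] and [E0]. *)
have [p hp] : exists p, forall E, finite_set E ->
    infinitely_often (fun m => Q (p + m.*2) E).
  have [even|] := pselect (forall E, finite_set E ->
    infinitely_often (fun m => Q (0 + m.*2) E)); first by exists 0.
  move=> /existsNP[E0 /not_implyP[E0fin /existsNP[N0' nE0]]].
  exists 1 => E Efin M.
  have [|k [kM Qk]] := Qio (E `|` E0) _ (N0' + M).*2.+1.
    by rewrite finite_setU.
  have [kodd|keven] := boolP (odd k).
    exists k./2; split.
      rewrite -leq_double -ltnS; move: kM; rewrite -{1}(odd_double_half k) kodd.
      move=> /(leq_trans _); apply; rewrite ltnS leq_double.
      exact: leq_addl.
    have -> : 1 + k./2.*2 = k by rewrite -[RHS]odd_double_half kodd.
    by apply: QS Qk => x; left.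
  case: nE0; exists k./2.
  have kE : k./2.*2 = k by rewrite -[RHS]odd_double_half (negbTE keven).
  split; last by rewrite add0n kE; apply: QS Qk => x; right.
  rewrite -leq_double kE; apply: leq_trans (ltnW kM).
  by rewrite leq_double leq_addr.
(* The initial indices, skipped when the pairing starts at 1, are absorbed by
   the first interval. *)
pose b m := if m == 0 then 0 else c (p + m.*2).
have bS m : b m < b m.+1.
  rewrite {2}/b /= doubleS !addnS /b; case: eqP => _; last first.
    exact: ltn_trans (cS _) (cS _).
  exact: leq_ltn_trans (leq0n _) (cS _).
have Vpart := block_partition _ _ b Vinj erefl bS.
exists (range (block V b)); split=> //.
  by move=> _ [k _ <-]; exact: finite_block.
apply: Omega_covers_intro.
- apply: (countableS _ _ (range (fun k => Union (block V b k)))).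
    by move=> _ [[_ [k _ <-] <-] _]; exists k.
  exact: range_countable.
- move=> _ [[_ [k _ <-] <-] _]; apply: bigcup_open => _ [i _ <-].
  exact: Vop.
- by move=> [_]; apply.
- move=> E /hp /(_ (maxn 1 N0))[m []]; rewrite geq_max => /andP[m0 Nm] QE.
  have bm : b m = c (p + m.*2) by rewrite /b -[m]prednK.
  have bm1 : b m.+1 = c (p + m.*2).+2 by rewrite /b /= doubleS !addnS.
  exists (Union (block V b m)); split.
    split; first by exists (block V b m) => //; exists m.
    move=> /= full1; apply: (notfull (b m) (b m.+1)).
      exact: leq_trans Nm (increasing_ge _ bS m).
    by move=> x; apply/block_Union; rewrite full1.
  by move=> x /QE; rewrite -bm -bm1 => ?; apply/block_Union.
Qed.

(** * The game on large covers *)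

(** Deleting the finitely many sets already chosen leaves a cover, because each
point lies in infinitely many members of a large cover. *)
Lemma no_winning_strategy_Lambda (X : topologicalType) (x0 : X) :
  S1 (@O_covers X) (@O_covers X) -> Ufin (@O_covers X) (@Omega_covers X) ->
  ~ exists sigma,
      G1_winning_ONE (@Lambda_covers X) (gimel (@Omega_covers X)) sigma.
Proof.
move=> S1O UF [sigma [sL swin]].
have /choice[E hE] : forall s, exists e : nat -> set X,
    (forall m, sigma s (e m) /\ e m \notin s) /\ forall x, exists m, e m x.
  move=> s; have [sO sinf] := sL s.
  have fresh x : exists V, [/\ sigma s V, V \notin s & V x].
    apply: contrapT => no; apply: (sinf x).
    apply: sub_finite_set (finite_seq s) => V [sV Vx] /=.
    by apply: contrapT => Vs; apply: no; exists V; split=> //; apply/negP.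
  have [e eE] : exists e : nat -> set X,
      range e = sigma s `&` [set V | V \notin s].
    apply: countable_range; last by have [V []] := fresh x0; exists V.
    by apply: countableS (_ : countable (sigma s)); [move=> V []|case: sO].
  exists e; split.
    by move=> m; have : range e (e m) by [exists m]; rewrite eE.
  move=> x; have [V [sV Vs Vx]] := fresh x.
  have : range e V by rewrite eE.
  by move=> [m _ mV]; exists m; rewrite mV.
pose hist := foldl (fun h m => rcons h (E h m)) [::].
have [t ht] : exists t : nat -> nat, forall x,
    infinitely_often (fun n => E (hist (mkseq t n)) (t n) x).
  apply: (rothberger_game _ x0 (fun s => E (hist s))) => //.
    move=> s m; have [sO _] := sL (hist s).
    by apply: O_cover_open sO _; have [/(_ m)[]] := hE (hist s).
  by move=> s; have [_] := hE (hist s).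
pose V n := E (hist (mkseq t n)) (t n).
have histV n : hist (mkseq t n) = mkseq V n.
  by elim: n => // n IH; rewrite !mkseqS /hist foldl_rcons -/hist -IH.
have hV n : sigma (mkseq V n) (V n) /\ V n \notin mkseq V n.
  by rewrite -histV; have [/(_ (t n))] := hE (hist (mkseq t n)).
apply: (swin V); first by move=> n; have [] := hV n.
have sO n : O_covers (sigma (mkseq V n)) by have [] := sL (mkseq V n).
apply: gimel_range => //.
- have VN m n : m < n -> V m <> V n.
    move=> mn Vmn; have [_ /negP] := hV n; apply.
    by rewrite -Vmn; apply/mapP; exists m => //; rewrite mem_iota.
  move=> m n Vmn; have [/VN//|/VN|//] := ltngtP m n.
  by move/(_ (esym Vmn)).
- by move=> n; apply: O_cover_open (sO n) _; have [] := hV n.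
- move=> n VT; have [_ _ _] := sO n; apply.
  by rewrite -VT; have [] := hV n.
Qed.

Lemma G1_S1 (X : topologicalType) (A B : set (set (set X))) :
  ~ (exists sigma, G1_winning_ONE A B sigma) -> S1 A B.
Proof.
move=> noG U AU; apply: contrapT => noV; apply: noG.
exists (fun s => U (size s)); split=> [s|V play BV]; first exact: AU.
apply: noV; exists V; split=> // n.
by have := play n; rewrite size_mkseq.
Qed.

(** * From the game to the partition relation *)

Lemma card_eq2P (T : Type) (s : set T) :
  (s #= `I_2)%card <-> exists x y, x <> y /\ s = [set x; y].
Proof.
elim/Pchoice: T => T in s *.
split.
  move=> /eq_cardSP[x sx /eq_cardSP[y [sy yx]]].
  rewrite II0 card_eq0 => /eqP s0; exists x, y; split.
    by move=> xy; apply: yx.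
  apply/seteqP; split=> [z sz|z [->|->]//].
  apply: contrapT => /not_orP[zx zy].
  have : ((s `\ x) `\ y) z by [].
  by rewrite s0.
move=> [x [y [xy ->]]]; apply/eq_cardSP; exists x; first by left.
suff -> : [set x; y] `\ x = [set y] by exact: card_set1.
apply/seteqP; split=> [z [[->|->]]//|z ->]; first by move=> /(_ erefl).
by split; [right|move=> yx; apply: xy].
Qed.

Lemma ultra_color (T : Type) (p : set_system T) (k : nat) (c : T -> 'I_k) :
  UltraFilter p -> exists j, p [set x | c x = j].
Proof.
move=> pU; apply: contrapT => no.
have : \forall x \near p, forall j, c x <> j.
  apply: filter_forall => j.
  by have [pj|//] := in_ultra_setVsetC [set x | c x = j] pU; case: no; exists j.
by move=> /filter_ex[x]; apply.
Qed.

(** The sets of members of [U] that contain a given finite set generate a proper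
filter, and a set that meets each of these is an omega-cover. *)
Lemma Omega_ultrafilter (X : topologicalType) (U : set (set X)) :
  Omega_covers U -> exists p : set_system (set X), UltraFilter p /\
    forall S, p S -> Omega_covers (U `&` S).
Proof.
move=> [[cU Uop _ UT] Uom].
pose F : set_system (set X) := [set S | exists E : set X, finite_set E /\
  forall V, U V -> E `<=` V -> S V].
have FF : ProperFilter F.
  apply: Build_ProperFilter_ex.
    move=> S [E [Efin ES]]; have [V [UV EV]] := Uom E Efin.
    by exists V; exact: ES.
  split.
  - by exists set0; split.
  - move=> S S' [E [Efin ES]] [E' [E'fin ES']]; exists (E `|` E').
    split; first by rewrite finite_setU.
    by move=> V UV; rewrite subUset => -[EV E'V]; split; [exact: ES|exact: ES'].
  - move=> S S' SS' [E [Efin ES]]; exists E; split=> //.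
    by move=> V UV EV; apply: SS'; exact: ES.
have [p [pU Fp]] := ultraFilterLemma FF; exists p; split=> // S pS.
apply: Omega_covers_intro.
- by apply: countableS cU => V [].
- by move=> V [/Uop].
- by move=> [].
- move=> E Efin.
  have pE : p [set V | U V /\ E `<=` V] by apply: Fp; exists E.
  have /filter_ex[V [SV [UV EV]]] : p (S `&` [set V | U V /\ E `<=` V]).
    exact: filterI.
  by exists V.
Qed.

(** The colour [c V] is the one that almost every pair containing [V] has, and
[j] is the value that [c] takes almost everywhere.  ONE only offers sets of
colour [j] that form a pair of colour [j] with each such set already chosen, so
every legal play is homogeneous. *)
Lemma game_arrow (X : topologicalType) (B : set (set (set X))) (k : nat) :
  ~ (exists sigma, G1_winning_ONE (@Omega_covers X) B sigma) ->
  arrow (@Omega_covers X) B 2 k.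
Proof.
move=> noG U Uom f.
have [p [pU pom]] := Omega_ultrafilter _ _ Uom.
have /choice[c hc] : forall V, exists j, p [set W | f [set V; W] = j].
  by move=> V; exact: ultra_color.
have [j hj] := ultra_color _ _ _ c pU.
pose sigma (s : seq (set X)) := U `&`
  ([set W | c W = j] `&`
   [set W | forall V, V \in s -> c V = j -> f [set V; W] = j]).
have somega s : Omega_covers (sigma s).
  apply: pom; apply: filterI => //.
  apply: filter_all_seq => V _.
  have [Vj|Vj] := pselect (c V = j); last by apply: filterE => W /Vj.
  by apply: filterS (hc V) => W; rewrite Vj.
apply: contrapT => noV; apply: noG; exists sigma; split=> // V play BV.
apply: noV; exists (range V); split=> //.
  by move=> _ [n _ <-]; have [] := play n.
exists j => s [sV /card_eq2P[x [y [xy sE]]]].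
have [m _ mx] : range V x by apply: sV; rewrite sE; left.
have [n _ ny] : range V y by apply: sV; rewrite sE; right.
have hom a b : a < b -> f [set V a; V b] = j.
  move=> ab; have [_ [_]] := play b; apply.
    by apply/mapP; exists a => //; rewrite mem_iota.
  by have [_ []] := play a.
rewrite sE -mx -ny; have [mn|nm|mn] := ltngtP m n; first exact: hom.
  by rewrite setUC; exact: hom.
by case: xy; rewrite -mx -ny mn.
Qed.

(** * Recovering the covering properties *)

(** A common weakening of S1(Omega, gimel(Omega)) and the partition relation,
from which both covering properties can be recovered. *)
Definition refining_selection (X : topologicalType) : Prop :=
  forall U : nat -> set (set X), (forall n, Omega_covers (U n)) ->
  exists (B : set (set X)) (nu : set X -> nat),
    [/\ gimel (@Omega_covers X) B,
        (forall V W, B V -> B W -> nu V = nu W -> V = W)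
      & forall V, B V -> exists W, U (nu V) W /\ V `<=` W].

Lemma S1_refining (X : topologicalType) :
  S1 (@Omega_covers X) (gimel (@Omega_covers X)) -> refining_selection X.
Proof.
move=> S1O U /S1O[V [UV Vg]].
have /choice[nu hnu] : forall W, exists n, range V W -> V n = W.
  move=> W; have [[n _ nW]|no] := pselect (range V W); first by exists n.
  by exists 0.
exists (range V), nu; split=> // [W W' /hnu {2}<- /hnu {2}<- -> //|W VW].
by exists W; split=> //; rewrite -{2}(hnu W VW).
Qed.

(** Colour a pair of sets of the form [e 0 n `&` e n k] by whether the indices
[n] agree.  If they agreed throughout a homogeneous set, all its members would
lie in the single proper subset [e 0 n]; so they are pairwise distinct. *)
Lemma arrow_refining (X : topologicalType) (x0 : X) :
  arrow (@Omega_covers X) (gimel (@Omega_covers X)) 2 2 -> refining_selection X.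
Proof.
move=> arr U Uom.
have /choice[e he] : forall n, exists e : nat -> set X, range e = U n.
  by move=> n; apply: (O_cover_enum _ x0); case: (Uom n).
have Ue n k : U n (e n k) by rewrite -he; exists k.
pose C (nk : nat * nat) := e 0 nk.1 `&` e nk.1 nk.2.
have Cproper n : exists y, ~ e 0 n y.
  by apply: (O_cover_proper _ (U 0)); [case: (Uom 0)|exact: Ue].
have Com : Omega_covers (range C).
  apply: Omega_covers_intro.
  - exact: range_countable.
  - move=> _ [[n k] _ <-]; apply: openI.
      by apply: (O_cover_open _ (U 0)); [case: (Uom 0)|exact: Ue].
    by apply: (O_cover_open _ (U n)); [case: (Uom n)|exact: Ue].
  - move=> [[n k] _ CT]; have [y] := Cproper n; apply.
    by have : setT y by []; rewrite -CT => -[].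
  - move=> E Efin; have [_ /(_ E Efin)[V []]] := Uom 0.
    rewrite -he => -[n _ <-] En.
    have [_ /(_ E Efin)[W []]] := Uom n; rewrite -he => -[k _ <-] Ek.
    exists (C (n, k)); split; first by exists (n, k).
    by move=> x Ex; split; [exact: En|exact: Ek].
have /choice[nu hnu] : forall W, exists nk, range C W -> C nk = W.
  move=> W; have [[n _ nW]|no] := pselect (range C W); first by exists n.
  by exists (0, 0).
pose same (s : set (set X)) :=
  exists V W, [/\ s V, s W, V <> W & (nu V).1 = (nu W).1].
pose f s : 'I_2 := if `[< same s >] then ord0 else ord_max.
have [B [BC Bg [j hB]]] := arr _ Com f.
have hpair V W : B V -> B W -> V <> W -> f [set V; W] = j.
  move=> BV BW VW; apply: hB; split; first by move=> _ [->|->].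
  by apply/card_eq2P; exists V, W.
exists B, (fun V => (nu V).1); split=> //; last first.
  move=> V BV; exists (e (nu V).1 (nu V).2); split; first exact: Ue.
  by rewrite -{1}(hnu V (BC _ BV)) => x [].
move=> V W BV BW nuVW; apply: contrapT => VW.
have j0 : j = ord0.
  rewrite -(hpair V W BV BW VW) /f; case: asboolP => // -[].
  by exists V, W; split=> //; [left|right].
have BO : O_covers B by case: Bg.
have Bnu W' : B W' -> (nu W').1 = (nu V).1.
  move=> BW'; have [->//|WV'] := pselect (W' = V).
  have := hpair W' V BW' BV WV'; rewrite j0 /f; case: asboolP => // + _.
  by move=> [P [Q [[->|->] [->|->]]]].
have [y hy] := Cproper (nu V).1.
have [W' [BW' Wy]] := O_cover_mem _ _ y BO.
by apply: hy; move: Wy; rewrite -(hnu W' (BC _ BW')) -(Bnu W' BW') => -[].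
Qed.

(** Each omega-cover consists of finite unions that use at most one member from
each cover with an index of the form [pickle (n, j)].  A selected union uses
indices that belong to its own [n], so the selected unions decompose without
conflict. *)
Lemma refining_S1_O (X : topologicalType) (x0 : X) :
  refining_selection X -> S1 (@O_covers X) (@O_covers X).
Proof.
move=> ref U UO.
have /choice[e he] : forall n, exists e : nat -> set X, range e = U n.
  by move=> n; exact: (O_cover_enum _ x0).
have Ue n k : U n (e n k) by rewrite -he; exists k.
pose S (n : nat) (a : seq nat) : set X :=
  [set x | exists j, j < size a /\ e (pickle (n, j)) (nth 0 a j) x].
have [a ha] : exists a : nat -> seq nat, forall x, exists n, S n (a n) x.
  have [[n [a aT]]|noT] := pselect (exists n a, S n a = setT).
    by exists (fun=> a) => x; exists n; rewrite aT.
  have Som n : Omega_covers (range (S n)).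
    apply: Omega_covers_intro.
    - exact: range_countable.
    - move=> _ [a _ <-]; rewrite openE => x [j [ja ex]].
      have /open_nbhs_nbhs : open_nbhs x (e (pickle (n, j)) (nth 0 a j)).
        by split=> //; exact: O_cover_open (UO _) (Ue _ _).
      by apply: filterS => y ey; exists j.
    - by move=> [a _ aT]; apply: noT; exists n, a.
    - move=> E /finite_seqP[s ->].
      have /choice[m hm] : forall x, exists k, e (pickle (n, index x s)) k x.
        move=> x; have [V []] := O_cover_mem _ _ x (UO (pickle (n, index x s))).
        by rewrite -he => -[k _ <-]; exists k.
      exists (S n [seq m x | x <- s]); split.
        by exists [seq m x | x <- s].
      move=> x /= xs; exists (index x s).
      by rewrite size_map index_mem (nth_map x0) ?index_mem// nth_index.
  have [B [nu [[BO _] nuinj hB]]] := ref _ Som.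
  have /choice[a ha] : forall n, exists a, forall V, B V -> nu V = n ->
      V `<=` S n a.
    move=> n; have [[V [BV Vn]]|no] := pselect (exists V, B V /\ nu V = n).
      have [_ [[a _ <-] VS]] := hB V BV; exists a => W BW Wn.
      by rewrite (nuinj W V) ?Wn// -Vn.
    by exists [::] => V BV Vn; case: no; exists V.
  exists a => x; have [V [BV Vx]] := O_cover_mem _ _ x BO.
  by exists (nu V); apply: (ha _ V).
pose V m := e m (if unpickle m is Some nj then nth 0 (a nj.1) nj.2 else 0).
exists V; split=> [m|]; first exact: Ue.
apply: O_covers_range.
- by move=> m; exact: O_cover_open (UO _) (Ue _ _).
- move=> x; have [n [j [_ ex]]] := ha x.
  by exists (pickle (n, j)); rewrite /V pickleK.
- by move=> m VT; have [_ _ _] := UO m; apply; rewrite -VT; exact: Ue.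
Qed.

(** The sets [C n k] increase with [k] and are contained in proper finite unions
[D i k] for every [i <= n].  Hence a finite part of the selected family with
indices at least [n] has its union inside one [D n k].  In particular no finite
part covers the space, which excludes the multifinite alternative, and each
block of the partition is charged to the least index occurring in it. *)
Lemma refining_Ufin (X : topologicalType) (x0 : X) :
  refining_selection X -> Ufin (@O_covers X) (@Omega_covers X).
Proof.
move=> ref U hU.
have UO n : O_covers (U n) by case: (hU n).
have /choice[e he] : forall n, exists e : nat -> set X, range e = U n.
  by move=> n; exact: (O_cover_enum _ x0).
have Ue n k : U n (e n k) by rewrite -he; exists k.
pose D n k : set X := [set x | exists l, l <= k /\ e n l x].
have Dmono n k l : k <= l -> D n k `<=` D n l.
  by move=> kl x [i [ik ex]]; exists i; split=> //; exact: leq_trans kl.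
have DE n k : D n k = Union [set e n l | l in [set l | l <= k]].
  apply/seteqP; split=> [x [l [lk ex]]|x [_ [l lk <-] ex]]; last by exists l.
  by exists (e n l) => //; exists l.
have fin n k : finite_set [set e n l | l in [set l | l <= k]].
  by apply: finite_image; exact: (finite_II k.+1).
have Dop n k : open (D n k).
  rewrite DE; apply: bigcup_open => _ [l _ <-].
  exact: O_cover_open (UO _) (Ue _ _).
have DT n k : D n k <> setT.
  rewrite DE => DT; have [_] := hU n; apply.
  by exists [set e n l | l in [set l | l <= k]]; split=> // _ [l _ <-].
pose C n k : set X := [set x | forall i, i \in iota 0 n.+1 -> D i k x].
have Com n : Omega_covers (range (C n)).
  apply: Omega_covers_intro.
  - exact: range_countable.
  - move=> _ [k _ <-]; rewrite openE => x Cx.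
    have : \forall y \near x, forall i, i \in iota 0 n.+1 -> D i k y.
      apply: filter_all_seq => i /Cx Dx.
      by apply: open_nbhs_nbhs; split.
    exact: filterS.
  - move=> [k _ CT]; apply: (DT 0 k); apply/seteqP; split=> // x _.
    by have : C n k x; [rewrite CT|apply; rewrite mem_iota].
  - move=> E Efin.
    have [k hk] : exists k, forall x, E x -> C n k x.
      apply: (finite_set_bounded _ E (fun x k => C n k x)) => //.
        by move=> x k l kl Ck i /Ck; exact: Dmono.
      move=> x _; apply: (finite_set_bounded _ [set` iota 0 n.+1]
        (fun i k => D i k x)).
      - exact: finite_seq.
      - by move=> i k l kl; exact: Dmono.
      - move=> i _; have [V []] := O_cover_mem _ _ x (UO i).
        by rewrite -he => -[k _ <-] ex; exists k, k.
    by exists (C n k); split=> //; exists k.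
have [B [nu [[BO Bgimel] nuinj hB]]] := ref _ Com.
have Bsub n F : finite_set F -> F `<=` B -> (forall V, F V -> n <= nu V) ->
    exists k, Union F `<=` D n k.
  move=> Ffin FB Fn.
  have [k hk] : exists k, forall V, F V -> V `<=` D n k.
    apply: (finite_set_bounded _ F (fun V k => V `<=` D n k)) => //.
      by move=> V k l kl Vk x /Vk; exact: Dmono.
    move=> V FV; have [_ [[k _ <-] VC]] := hB V (FB V FV).
    exists k => x /VC; apply; rewrite mem_iota/= ltnS; exact: Fn.
  by exists k => x [V FV Vx]; exact: hk Vx.
have [P [[Pcov Ptriv Pne] Pfin Pom]] : exists P : set (set (set X)),
    [/\ partition P id B, (forall F, P F -> finite_set F)
      & Omega_covers ([set Union F | F in P] `\ setT)].
  case: Bgimel => // -[P [[Pcov _ _] Pinf PO]].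
  have [F PF] := infinite_setN0 Pinf; have [Ffin [_ _ FT _]] := PO F PF.
  have [|//|k] := Bsub 0 F Ffin.
    by move=> V FV; rewrite -Pcov; exists F.
  by rewrite FT => TD; case: (DT 0 k); apply/seteqP.
have PB F : P F -> F `<=` B by move=> PF V FV; rewrite -Pcov; exists F.
have /choice[k hk] : forall n, exists k, forall F, P F ->
    (exists V, F V /\ nu V = n) -> (forall V, F V -> n <= nu V) ->
    Union F `<=` D n k.
  (* At most one block has least index [n], since indices determine members. *)
  move=> n; have [[F [PF [V [FV Vn]] Fn]]|no] := pselect (exists F, [/\ P F,
      exists V, F V /\ nu V = n & forall V, F V -> n <= nu V]); last first.
    by exists 0 => F PF FV Fn; case: no; exists F.
  have [k hk] := Bsub n F (Pfin F PF) (PB F PF) Fn.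
  exists k => F' PF' [V' [FV' Vn']] _.
  suff -> : F' = F by [].
  apply: Ptriv => //; exists V; split=> //=.
  by rewrite (nuinj V V') ?Vn// ; [exact: (PB _ PF)|exact: (PB _ PF')].
exists (fun n => [set e n l | l in [set l | l <= k n]]); split.
  by move=> n; split=> // _ [l _ <-].
have -> : (fun n => Union [set e n l | l in [set l | l <= k n]]) =
    (fun n => D n (k n)) by apply/funext => n; rewrite DE.
apply: Omega_covers_intro.
- exact: range_countable.
- by move=> _ [n _ <-].
- by move=> [n _ /DT].
- move=> E Efin; have [_ /(_ E Efin)[_ [[[F PF <-] _] EF]]] := Pom.
  have [V0 FV0] := Pne F PF.
  have ex : exists n, `[< exists V, F V /\ nu V = n >].
    by exists (nu V0); apply/asboolP; exists V0.
  case: (ex_minnP ex) => n /asboolP Fn min.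
  exists (D n (k n)); split; first by exists n.
  move=> x /EF; apply: hk => // V FV; apply: min.
  by apply/asboolP; exists V.
Qed.

(** * The equivalence *)

Theorem theorem22 (X : topologicalType) (X_nonempty : [set: X] !=set0) :
  [<-> S1 (@O_covers X) (@O_covers X) /\
         Ufin (@O_covers X) (@Omega_covers X);
       S1 (@Lambda_covers X) (gimel (@Omega_covers X));
       S1 (@Omega_covers X) (gimel (@Omega_covers X));
       ~ (exists sigma : seq (set X) -> set (set X),
            G1_winning_ONE (@Omega_covers X) (gimel (@Omega_covers X)) sigma);
       arrow (@Omega_covers X) (gimel (@Omega_covers X)) 2 2;
       forall k : nat, (0 < k)%N ->
         arrow (@Omega_covers X) (gimel (@Omega_covers X)) 2 k].
Proof.
have [x0 _] := X_nonempty.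
have toLambda : S1 (@O_covers X) (@O_covers X) /\
      Ufin (@O_covers X) (@Omega_covers X) ->
    ~ exists sigma, G1_winning_ONE (@Lambda_covers X)
        (gimel (@Omega_covers X)) sigma.
  by move=> [S1O UF]; exact: no_winning_strategy_Lambda.
have toOmega : S1 (@O_covers X) (@O_covers X) /\
      Ufin (@O_covers X) (@Omega_covers X) ->
    ~ exists sigma, G1_winning_ONE (@Omega_covers X)
        (gimel (@Omega_covers X)) sigma.
  move=> /toLambda noL [sigma [sO swin]]; apply: noL; exists sigma.
  by split=> // s; exact: Omega_sub_Lambda.
have ofRefining : refining_selection X ->
    S1 (@O_covers X) (@O_covers X) /\ Ufin (@O_covers X) (@Omega_covers X).
  by move=> ref; split; [exact: refining_S1_O|exact: refining_Ufin].
tfae.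
- by move=> /toLambda; exact: G1_S1.
- by move=> S1L U UO; apply: S1L => n; exact: Omega_sub_Lambda.
- by move=> /S1_refining/ofRefining/toOmega.
- exact: game_arrow.
- move=> /(arrow_refining _ x0)/ofRefining/toOmega noG k _.
  exact: game_arrow.
- by move=> /(_ 2 isT)/(arrow_refining _ x0)/ofRefining.
Qed.
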